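(* Let $L$ be an algebraically closed field of characteristic $0$, let $n\ge 2$, and let $A_1,\dots,A_k\in\mathcal{M}_n(L)$ be any matrices. Let $g$ be a non-zero polynomial over $L$ in $k+1$ non-commuting indeterminates such that each monomial of $g$ contains explicitly the last variable (the one into which $X$ is substituted). Let $\phi:\mathcal{M}_n(L)\to\mathcal{M}_n(L)$ be the polynomial map $\phi(X)=g(A_1,\dots,A_k,X)$, and let $\delta$ be the degree of $\phi$. Then, generically with respect to $B\in\mathcal{M}_n(L)$, the equation $$g(A_1,\dots,A_k,X)=B\qquad\text{in the unknown }X\in\mathcal{M}_n(L)$$ has exactly $\delta$ solutions, and all of them are simple.
   Context: Degree of a polynomial map $f:L^N\to L^N$ (here $N=n^2$, $\mathcal{M}_n(L)\cong L^{N}$): let $R_N$ be the function field of $L^N$ with coefficients in $L$. If $f(L^N)$ is Zariski-dense in $L^N$, the degree of $f$ is $[R_N:f^*(R_N)]$; if the image is not Zariski-dense, the degree of $f$ is by convention $0$. ''Generically with respect to $B$'': there is a non-empty (hence dense) Zariski open set $U\subset\mathcal{M}_n(L)$ such that the stated property holds for every $B\in U$. Simple solution: the equation $\phi(X)=B$ is regarded as a system of $n^2$ polynomial equations $f_{i,j}=0$ in the entries of $X$; a solution $X_0$ is simple if it is isolated and of multiplicity $1$, where the multiplicity of an isolated solution is $\dim_L\mathcal{O}_{X_0}/((f_{i,j})_{i,j})_{X_0}$, with $\mathcal{O}_{X_0}$ the local ring of the affine space at $X_0$. *)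

(* Defs.v *)
(* Points of the affine space L^N are row vectors 'rV[L]_N, and M_n(L) is
   identified with L^(n * n) by mxvec / vec_mx. *)
From HB Require Import structures.
From mathcomp Require Import all_boot all_order all_algebra.
From mathcomp Require Import finmap boolp classical_sets.
(* monalg and mpoly declare conflicting notations; those of mpoly are kept. *)
From mathcomp Require Import -(notations) monalg.
From mathcomp Require Import mpoly.

Set Implicit Arguments.
Unset Strict Implicit.
Unset Printing Implicit Defensive.

Import GRing.Theory.
Local Open Scope ring_scope.
Local Open Scope classical_set_scope.

Section Dimension.
Variable R : fieldType.

(* [e] induces a basis of the quotient M / I over the subfield K of R, where
   M and I are K-subspaces of R with I included in M. *)
Definition is_quotient_basis (K M I : set R) d (e : 'I_d -> R) : Prop :=
  [/\ forall i, M (e i),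
      forall x, M x ->
        exists2 c : 'I_d -> R, forall i, K (c i) & I (x - \sum_i c i * e i)
    & forall c : 'I_d -> R, (forall i, K (c i)) ->
        I (\sum_i c i * e i) -> forall i, c i = 0].

(* The value is 0 if the dimension is infinite. *)
Definition quotient_dim (K M I : set R) : nat :=
  xget 0%N [set d : nat | exists e : 'I_d -> R, is_quotient_basis K M I e].

Definition ext_degree (K : set R) : nat := quotient_dim K setT [set 0].

End Dimension.

Section AffineSpace.
Variables (L : closedFieldType) (N : nat).

Definition func_field := {fraction {mpoly L[N]}}.

Definition zariski_open (U : set 'rV[L]_N) : Prop :=
  exists S : set {mpoly L[N]},
    U = [set x | exists2 p, S p & p.@[x ord0] != 0].

Definition zariski_dense (D : set 'rV[L]_N) : Prop :=
  forall U, zariski_open U -> U !=set0 -> U `&` D !=set0.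

Definition polymap (f : N.-tuple {mpoly L[N]}) (x : 'rV[L]_N) : 'rV[L]_N :=
  \row_i (tnth f i).@[x ord0].

(* The image of the function field under f^*; it is only meaningful if f has dense image, in which
   case q \mPo f != 0 for all q != 0. *)
Definition pullback_field (f : N.-tuple {mpoly L[N]}) : set func_field :=
  [set r | exists p q : {mpoly L[N]},
     q != 0 /\ r = tofrac (p \mPo f) / tofrac (q \mPo f)].

Definition degree (f : N.-tuple {mpoly L[N]}) : nat :=
  if `[< zariski_dense (range (polymap f)) >]
  then ext_degree (pullback_field f) else 0%N.

Definition const_field : set func_field :=
  range (fun c : L => tofrac c%:MP).

Definition local_ring (x0 : 'rV[L]_N) : set func_field :=
  [set r | exists p q : {mpoly L[N]},
     q.@[x0 ord0] != 0 /\ r = tofrac p / tofrac q].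

Definition local_ideal (f : N.-tuple {mpoly L[N]}) (x0 : 'rV[L]_N) :
    set func_field :=
  [set r | exists2 c : 'I_N -> func_field,
     forall i, local_ring x0 (c i) & r = \sum_i c i * tofrac (tnth f i)].

Definition solution (f : N.-tuple {mpoly L[N]}) (x : 'rV[L]_N) : Prop :=
  forall i, (tnth f i).@[x ord0] = 0.

Definition isolated_solution (f : N.-tuple {mpoly L[N]}) (x0 : 'rV[L]_N) :=
  solution f x0 /\
  exists U, [/\ zariski_open U, U x0 & forall x, U x -> solution f x -> x = x0].

Definition multiplicity (f : N.-tuple {mpoly L[N]}) (x0 : 'rV[L]_N) : nat :=
  quotient_dim const_field (local_ring x0) (local_ideal f x0).

Definition simple_solution (f : N.-tuple {mpoly L[N]}) (x0 : 'rV[L]_N) : Prop :=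
  isolated_solution f x0 /\ multiplicity f x0 = 1%N.

End AffineSpace.

(* Polynomials over L in k non-commuting indeterminates: the algebra over L of
   the free monoid on 'I_k. *)
Definition ncpoly (L : closedFieldType) (k : nat) := malg (fmonom 'I_k) L.

Section MatrixEquation.
Variables (L : closedFieldType) (n k : nat).
Implicit Types (A : 'I_k -> 'M[L]_n) (g : ncpoly L k.+1) (X B : 'M[L]_n).

Definition nceval (R : comNzRingType) (c : L -> R) g (V : 'I_k.+1 -> 'M[R]_n) :
    'M[R]_n :=
  \sum_(m <- monalg.msupp g) c (monalg.mcoeff m g) *: \prod_(i <- m) V i.

(* The last indeterminate is the one with index ord_max. *)
Definition extend_last (T : Type) (a : 'I_k -> T) (x : T) (i : 'I_k.+1) : T :=
  oapp a x (unlift ord_max i).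

Definition phi A g X : 'M[L]_n := nceval id g (extend_last A X).

Definition generic_mx : 'M[{mpoly L[n * n]}]_n :=
  \matrix_(i, j) 'X_(mxvec_index i j).

Definition phi_mpoly A g : (n * n).-tuple {mpoly L[n * n]} :=
  let P := nceval (@mpolyC (n * n) L) g
             (extend_last (fun i => map_mx (@mpolyC (n * n) L) (A i))
                generic_mx) in
  [tuple mxvec P ord0 l | l < n * n].

Definition phi_system A g B : (n * n).-tuple {mpoly L[n * n]} :=
  [tuple tnth (phi_mpoly A g) l - (mxvec B ord0 l)%:MP | l < n * n].

Definition generically (P : 'M[L]_n -> Prop) : Prop :=
  exists U : set 'M[L]_n,
    [/\ zariski_open [set v | U (vec_mx v)], U !=set0 & forall B, U B -> P B].

Lemma polymap_phi A g X : polymap (phi_mpoly A g) (mxvec X) = mxvec (phi A g X).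
Proof.
apply/rowP=> l; rewrite mxE tnth_mktuple; case/mxvec_indexP: l => i j.
rewrite !mxvecE /phi /nceval !summxE raddf_sum /=.
apply: eq_bigr => m _; rewrite !mxE mevalM mevalC; congr (_ * _).
suff ->: \prod_(a <- m) extend_last A X a = map_mx (meval (mxvec X ord0))
    (\prod_(a <- m) extend_last (fun i => map_mx (@mpolyC (n * n) L) (A i))
                generic_mx a) by rewrite mxE.
elim: (fmonom_val m) => [|a s IHs]; first by rewrite !big_nil map_mx1.
rewrite !big_cons map_mxM IHs; congr (_ *m _).
rewrite /extend_last; case: unlift => [b|] /=; apply/matrixP=> r t.
  by rewrite !mxE mevalC.
by rewrite !mxE mevalXU mxvecE.
Qed.

Lemma solution_phi_system A g B X :
  solution (phi_system A g B) (mxvec X) <-> phi A g X = B.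
Proof.
have E l : (tnth (phi_system A g B) l).@[mxvec X ord0]
    = mxvec (phi A g X) ord0 l - mxvec B ord0 l.
  by rewrite tnth_mktuple mevalB mevalC -polymap_phi mxE.
split=> [sX|eB l]; last by rewrite E eB subrr.
apply: (can_inj mxvecK); apply/rowP=> l.
by apply/subr0_eq; rewrite -E sX.
Qed.

End MatrixEquation.

(* Main.v *)
(* If phi is not dominant, some non-empty open set misses its image.  Otherwise
   let f be the tuple of components of phi, K = L(f) and R = L(x).  A count of
   monomials shows that R is algebraic over K, so in characteristic 0 we have
   R = K(theta) with theta in L[x], with separable minimal polynomial m over K
   and x_i = H_i(theta).  For b outside a hypersurface, m, the H_i and the
   finitely many identities
     theta(H) = t mod m,   f_j(H) = y_j mod m,   u m + v m' = 1
   can be specialized at y = b, and t |-> (H_i(b, t))_i is then a bijection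
   from the roots of m_b, which are simple and deg m = [R : K] in number, onto
   the fibre over b, with inverse theta.  Modulo the ideal of f - b in the
   local ring at the point of parameter t0 one has m_b(theta) = 0, where
   theta - t is invertible for every other root t; hence theta = t0, and
   x_i = H_i(b, t0): the ideal is the maximal ideal and the multiplicity is 1. *)
Require Import Defs.
From mathcomp Require Import all_boot all_order all_algebra separable.
From mathcomp Require Import finmap boolp classical_sets.
From mathcomp Require Import -(notations) monalg.
From mathcomp Require Import mpoly.
From mathcomp Require generic_quotient.
From HB Require Import structures.

Set Implicit Arguments.
Unset Strict Implicit.
Unset Printing Implicit Defensive.

Import GRing.Theory.
Local Open Scope ring_scope.

(** * Invariance of the dimension of a quotient *)

(** [quotient_dim] selects some basis size, so uniqueness is what matters: the transition matrices
    between two bases multiply to the identity by freeness, which bounds each size by the other. *)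
Lemma quotient_dimE (R : fieldType) (K M I : set R) d (e : 'I_d -> R) :
  K 1 -> (forall x y, K x -> K y -> K (x - y)) ->
  (forall x y, K x -> K y -> K (x * y)) ->
  I 0 -> (forall x y, I x -> I y -> I (x - y)) ->
  (forall x y, K x -> I y -> I (x * y)) ->
  is_quotient_basis K M I e -> quotient_dim K M I = d.
Proof.
move=> K1 KB KM I0 IB IM be; rewrite /quotient_dim.
have K0 : K 0 by rewrite -(subrr 1); apply: KB.
have KD x y : K x -> K y -> K (x + y).
  by move=> Kx Ky; rewrite -[y]opprK -(sub0r y); apply: (KB) => //; apply: KB.
have ID x y : I x -> I y -> I (x + y).
  by move=> Ix Iy; rewrite -[y]opprK -(sub0r y); apply: (IB) => //; apply: IB.
have span a b (u : 'I_a -> R) (v : 'I_b -> R) :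
    (forall i, M (u i)) -> is_quotient_basis K M I v ->
    exists C : 'M[R]_(a, b), (forall i j, K (C i j)) /\
      forall i, I (u i - \sum_j C i j * v j).
  move=> uM [_ vspan _].
  have /choice[c cP] i : exists c : 'I_b -> R,
      (forall j, K (c j)) /\ I (u i - \sum_j c j * v j).
    by have [c Kc Ic] := vspan _ (uM i); exists c.
  exists (\matrix_(i, j) c i j).
  split=> [i j|i]; first by rewrite mxE; have [] := cP i.
  have [_] := cP i; congr (I (_ - _)).
  by apply: eq_bigr => j _; rewrite mxE.
have le a b (u : 'I_a -> R) (v : 'I_b -> R) :
    is_quotient_basis K M I u -> is_quotient_basis K M I v -> (a <= b)%N.
  move=> bu bv; case: (bu) (bv) => uM _ ufree [vM _ _].
  have [C [KC IC]] := span _ _ _ _ uM bv.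
  have [D [KD' ID']] := span _ _ _ _ vM bu.
  apply: (@mulmx1_min R _ _ C D); apply/matrixP => i k; rewrite !mxE.
  apply/eqP; rewrite eq_sym -subr_eq0; apply/eqP; move: k.
  have Ksum (J : finType) (F : J -> R) : (forall j, K (F j)) -> K (\sum_j F j).
    by move=> KF; elim/big_ind: _ => [||j _]; [by [] | exact: KD | exact: KF].
  apply: ufree => [k|].
    by apply: KB; [case: (i == k) | apply: Ksum => j; apply: KM].
  (* Row i of 1 - CD gives a relation on [u] modulo [I]: the defect of u_i plus the defects of the
     v_j weighted by [C]. *)
  have -> : \sum_k ((i == k)%:R - \sum_j C i j * D j k) * u k
      = (u i - \sum_j C i j * v j) + \sum_j C i j * (v j - \sum_k D j k * u k).
    under eq_bigr do rewrite mulrBl; rewrite sumrB (bigD1 i) //= eqxx mul1r.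
    rewrite big1 ?addr0; last first.
      by move=> k; rewrite eq_sym => /negPf ->; rewrite mul0r.
    rewrite -addrA; congr (_ + _).
    have -> : \sum_j C i j * (v j - \sum_k D j k * u k)
        = \sum_j C i j * v j - \sum_j C i j * \sum_k D j k * u k.
      by rewrite -sumrB; apply: eq_bigr => j _; rewrite mulrBr.
    rewrite addrA addNr sub0r.
    congr (- _); under eq_bigr do rewrite mulr_suml; rewrite exchange_big.
    apply: eq_bigr => j _; rewrite mulr_sumr.
    by apply: eq_bigr => k _; rewrite mulrA.
  apply: (ID) => //; elim/big_ind: _ => [||j _]; [by [] | exact: ID |].
  exact: IM.
apply: xget_unique => [|c [v bv]]; first by exists e.
by apply/eqP; rewrite eqn_leq (le _ _ _ _ be bv) (le _ _ _ _ bv be).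
Qed.

(** * Polynomials in several variables: induction and non-vanishing *)

Lemma mpoly_ring_ind (R : comNzRingType) N (P : {mpoly R[N]} -> Prop) :
  (forall c, P c%:MP) -> (forall i, P 'X_i) ->
  (forall p q, P p -> P q -> P (p + q)) ->
  (forall p q, P p -> P q -> P (p * q)) -> forall p, P p.
Proof.
move=> PC PX PD PM p; rewrite [p]mpolyE.
elim/big_ind: _ => [||m _]; [by rewrite -mpolyC0 | exact: PD |].
rewrite -mul_mpolyC; apply: (PM) => //; rewrite mpolyXE_id.
elim/big_ind: _ => [||i _]; [by rewrite -mpolyC1 | exact: PM |].
by elim: (m i) => [|k IH]; rewrite ?expr0 -?mpolyC1 // exprS; apply: PM.
Qed.

Lemma mpoly_rmorph_ext (R S : comNzRingType) N
    (F G : {rmorphism {mpoly R[N]} -> S}) :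
  (forall c, F c%:MP = G c%:MP) -> (forall i, F 'X_i = G 'X_i) -> F =1 G.
Proof.
move=> FGC FGX; elim/mpoly_ring_ind => // p q Fp Fq.
  by rewrite !rmorphD Fp Fq.
by rewrite !rmorphM Fp Fq.
Qed.

(** In characteristic 0 the first [size p] naturals are distinct in [R], one more than [p] can have
    roots. *)
Lemma pchar0_nonroot (R : idomainType) (p : {poly R}) :
  [pchar R] =i pred0 -> p != 0 -> exists n, p.[n%:R] != 0.
Proof.
move=> /pcharf0P ch0 p0.
pose rs := [seq n%:R : R | n <- iota 0 (size p)].
case: (boolP (all (root p) rs)) => [allr|/allPn[_ /mapP[n _ ->]] nr].
  have: uniq rs.
    rewrite map_inj_in_uniq ?iota_uniq // => a b _ _ ab.
    wlog le : a b ab / (a <= b)%N => [H|].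
      by case/orP: (leq_total a b) => ?; [|symmetry]; apply: H.
    apply/eqP; rewrite eqn_leq le /= -subn_eq0 -ch0 natrB // ab subrr eqxx //.
  by move=> /(max_poly_roots p0 allr); rewrite size_map size_iota ltnn.
by exists n.
Qed.

(** Constants replace the variables one at a time: the polynomial is read as univariate in the
    current variable, over [{mpoly R[N]}] itself, and some natural number is not a root. *)
Lemma mpoly_nonvanishing (R : idomainType) N (p : {mpoly R[N]}) :
  [pchar R] =i pred0 -> p != 0 -> exists v : 'rV[R]_N, p.@[v ord0] != 0.
Proof.
move=> ch0 p0.
have chA : [pchar {mpoly R[N]}] =i pred0.
  apply/pcharf0P => k; rewrite -mpolyC_nat mpolyC_eq0.
  by move/pcharf0P: ch0.
pose sub (s : seq 'I_N) (v : 'I_N -> R) : N.-tuple {mpoly R[N]} :=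
  [tuple if i \in s then (v i)%:MP else 'X_i | i < N].
suff step s : uniq s -> exists v, p \mPo (sub s v) != 0.
  have [v] := step _ (enum_uniq 'I_N).
  have ->: p \mPo sub (enum 'I_N) v = (p.@[v])%:MP.
    apply: (mpoly_rmorph_ext (F := comp_mpoly (sub (enum 'I_N) v))
      (G := @mpolyC N R \o meval v)) => [c|i] /=.
      by rewrite comp_mpolyC mevalC.
    by rewrite comp_mpolyXU mevalXU -tnth_nth tnth_mktuple mem_enum.
  rewrite mpolyC_eq0 => nz; exists (\row_i v i).
  by rewrite (meval_eq (v2 := v)) // => i; rewrite mxE.
elim: s => [_|i s IHs /= /andP[isn /IHs[v]]].
  exists (fun _ => 0).
  suff -> : sub [::] (fun=> 0) = [tuple 'X_i | i < N] by rewrite comp_mpoly_id.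
  by apply: eq_from_tnth => i; rewrite !tnth_mktuple.
set q := p \mPo _ => q0.
pose h (j : 'I_N) : {poly {mpoly R[N]}} := if j == i then 'X else ('X_j)%:P.
pose Q := mmap (polyC \o @mpolyC N R) h q.
have Qx (x : {mpoly R[N]}) :
    Q.[x] = q \mPo [tuple if j == i then x else 'X_j | j < N].
  apply: (mpoly_rmorph_ext
    (F := horner_eval x \o mmap (polyC \o @mpolyC N R) h)
    (G := comp_mpoly [tuple if j == i then x else 'X_j | j < N])) => [c|j] /=.
    by rewrite mmapC comp_mpolyC /= /horner_eval hornerC.
  rewrite mmapX mmap1U comp_mpolyXU -tnth_nth tnth_mktuple /h /horner_eval.
  by case: eqP => _; rewrite ?hornerX ?hornerC.
have Q0 : Q != 0.
  (* Substituting ['X_i] for the new variable of [Q] gives [q] back. *)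
  apply: contraNneq q0 => Q0; move: (Qx 'X_i); rewrite Q0 horner0.
  have -> : [tuple if j == i then 'X_i else 'X_j | j < N]
      = [tuple 'X_j | j < N] :> N.-tuple {mpoly R[N]}.
    by apply: eq_from_tnth => j; rewrite !tnth_mktuple; case: eqP => // ->.
  by rewrite comp_mpoly_id => <-.
have [n] := pchar0_nonroot chA Q0.
rewrite Qx => nz; exists (fun j => if j == i then n%:R else v j).
congr (_ != 0): nz; rewrite /q.
apply: (mpoly_rmorph_ext (G := comp_mpoly _)
  (F := comp_mpoly [tuple if j == i then n%:R else 'X_j | j < N]
        \o comp_mpoly (sub s v))) => [c|j] /=; first by rewrite !comp_mpolyC.
rewrite !comp_mpolyXU -!tnth_nth !tnth_mktuple inE.
case: eqP => [->|/eqP nji] /=.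
  by rewrite (negPf isn) comp_mpolyXU -tnth_nth tnth_mktuple eqxx mpolyC_nat.
case: ifP => _; rewrite ?comp_mpolyC // comp_mpolyXU -tnth_nth tnth_mktuple.
by rewrite (negPf nji).
Qed.

(** * Fraction fields and the extension of injective morphisms *)

Lemma tofrac_inj (A : idomainType) : injective (@tofrac A).
Proof. by move=> x y /eqP; rewrite tofrac_eq => /eqP. Qed.

Lemma frac_repr (A : idomainType) (x : {fraction A}) :
  x = tofrac (generic_quotient.repr x).1 / tofrac (generic_quotient.repr x).2.
Proof.
set r := generic_quotient.repr x; have d0 : r.2 != 0 := denom_ratioP _.
apply: (canRL (mulfK _)); first by rewrite tofrac_eq0.
rewrite -[x]generic_quotient.reprK -/r.
unlock tofrac; rewrite -[LHS]FracField.pi_mul /FracField.mulf /=.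
rewrite !numden_Ratio ?oner_neq0 // mulr1.
apply/eqP; rewrite FracField.equivf_def.
by rewrite !numden_Ratio ?oner_neq0 // mulr1 mulrC.
Qed.

Lemma fracP (A : idomainType) (x : {fraction A}) :
  exists a b : A, b != 0 /\ x = tofrac a / tofrac b.
Proof. by do 2!eexists; split; last exact: frac_repr; apply: denom_ratioP. Qed.

Section FractionLift.
Variables (A : idomainType) (F : fieldType) (phi : {rmorphism A -> F}).

(* The unused proof argument lets the morphism structure below be inferred. *)
Definition frac_lift (_ : injective phi) (x : {fraction A}) : F :=
  phi (generic_quotient.repr x).1 / phi (generic_quotient.repr x).2.

Hypothesis phi_inj : injective phi.
Local Notation lift := (frac_lift phi_inj).

Let phi_neq0 c : c != 0 -> phi c != 0.
Proof. by move=> c0; rewrite raddf_eq0. Qed.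

(** The chosen representative does not matter: equality of fractions is a cross-product identity in
    [A], which [phi] preserves. *)
Lemma frac_lift_div a b : b != 0 -> lift (tofrac a / tofrac b) = phi a / phi b.
Proof.
move=> b0; set x := _ / _; rewrite /frac_lift.
set r := generic_quotient.repr x; have d0 : r.2 != 0 := denom_ratioP _.
apply/eqP; rewrite eqr_div ?phi_neq0 // -!rmorphM (inj_eq phi_inj) -tofrac_eq.
rewrite !tofracM -eqr_div ?tofrac_eq0 //; apply/eqP.
by rewrite -frac_repr.
Qed.

Lemma frac_lift_tofrac a : lift (tofrac a) = phi a.
Proof.
by rewrite -[tofrac a]divr1 -tofrac1 frac_lift_div ?oner_neq0 // rmorph1 divr1.
Qed.

Lemma frac_lift_is_zmod_morphism : zmod_morphism lift.
Proof.
move=> x y; have [a [b [b0 ->]]] := fracP x; have [c [d [d0 ->]]] := fracP y.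
rewrite -mulNr addf_div ?tofrac_eq0 // -rmorphN -!rmorphM -rmorphD.
rewrite !frac_lift_div ?mulf_neq0 // rmorphD !rmorphM rmorphN -mulNr.
by rewrite addf_div ?phi_neq0 //.
Qed.

Lemma frac_lift_is_monoid_morphism : monoid_morphism lift.
Proof.
split=> [|x y]; first by rewrite -tofrac1 frac_lift_tofrac rmorph1.
have [a [b [b0 ->]]] := fracP x; have [c [d [d0 ->]]] := fracP y.
by rewrite mulf_div -!rmorphM !frac_lift_div ?mulf_neq0 // mulf_div !rmorphM.
Qed.

HB.instance Definition _ := GRing.isZmodMorphism.Build {fraction A} F lift
  frac_lift_is_zmod_morphism.
HB.instance Definition _ := GRing.isMonoidMorphism.Build {fraction A} F lift
  frac_lift_is_monoid_morphism.

End FractionLift.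

(** * Simple algebraic extensions *)

Section SimpleExtension.
Variables (K F : fieldType) (iota : {rmorphism K -> F}).
Local Notation "p ^ f" := (map_poly f p) : ring_scope.

Definition algebraic_elt (x : F) :=
  exists2 p : {poly K}, p != 0 & root (p ^ iota) x.

(** The ring iota(K)[x], which is the field iota(K)(x) once [x] is algebraic. *)
Definition in_simple_ext (x y : F) := exists p : {poly K}, (p ^ iota).[x] = y.

Definition is_minimal_poly (m : {poly K}) (x : F) :=
  m != 0 /\ forall p, root (p ^ iota) x = (m %| p).

(** An annihilator of least size works: a non-zero remainder modulo it would be a smaller one. *)
Lemma minimal_polyP x : algebraic_elt x -> exists m, is_minimal_poly m x.
Proof.
case=> p0 p0n p0x.
pose P n := `[< exists2 p : {poly K}, p != 0 & root (p ^ iota) x /\ size p = n >].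
have exP : exists n, P n by exists (size p0); apply/asboolP; exists p0.
case: (ex_minnP exP) => n /asboolP[m mn0 [mx <-]] min_m.
exists m; split=> // p; apply/idP/idP => [px|/dvdpP[q ->]]; last first.
  by rewrite rmorphM rootM mx orbT.
rewrite /dvdp; apply: contraT => r0.
have /min_m : P (size (p %% m)).
  apply/asboolP; exists (p %% m) => //; split=> //.
  move: px; rewrite {1}(divp_eq p m) rmorphD rmorphM /root hornerD hornerM.
  by rewrite (rootP mx) mulr0 add0r.
by rewrite leqNgt ltn_modp mn0.
Qed.

Section Minimal.
Variables (m : {poly K}) (x : F).
Hypothesis min_m : is_minimal_poly m x.

(** Irreducibility of [m] in use: in m = h gcd(m, p), a root [x] of the gcd would give m | p; hence
    [x] is a root of [h], so m | h and the gcd is constant by degree. *)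
Lemma minimal_poly_coprime p : ~~ root (p ^ iota) x -> coprimep m p.
Proof.
case: min_m => m0 mP npx.
have /dvdpP[h Dm] := dvdp_gcdl m p.
have : root ((h * gcdp m p) ^ iota) x by rewrite -Dm mP.
rewrite rmorphM rootM => /orP[|] hx; last first.
  by rewrite mP in hx; rewrite mP (dvdp_trans hx) ?dvdp_gcdr in npx.
have g0 : gcdp m p != 0 by rewrite gcdp_eq0 (negPf m0).
have h0 : h != 0 by apply: contraNneq m0 => h0; rewrite Dm h0 mul0r.
rewrite mP in hx; have := dvdp_leq h0 hx; rewrite {1}Dm size_mul //.
rewrite /coprimep; move: (size_poly_gt0 (gcdp m p)); rewrite g0.
case: (size (gcdp m p)) => [|[|k]] // _.
by rewrite !addnS /= ltnNge leq_addr.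
Qed.

Lemma minimal_poly_size_gt1 : (1 < size m)%N.
Proof.
case: min_m => m0 mP; rewrite ltnNge; apply/negP => sz.
have : root (m ^ iota) x by rewrite mP.
rewrite (size1_polyC sz) map_polyC rootC fmorph_eq0 -polyC_eq0.
by rewrite -size1_polyC // (negPf m0).
Qed.

(** In characteristic 0 the derivative is non-zero of lower degree, hence not a multiple of [m]. *)
Lemma minimal_poly_separable : [pchar K] =i pred0 -> coprimep m m^`().
Proof.
move=> /pcharf0P ch0; case: (min_m) => m0 mP; apply: minimal_poly_coprime.
rewrite mP; apply/negP => dvd.
have m'0 : m^`() != 0.
  apply/eqP => /polyP/(_ (size m).-2); rewrite coef0 coef_deriv => /eqP.
  have := minimal_poly_size_gt1; case sz: (size m) => [|[|k]] //= _.
  rewrite -mulr_natr mulf_eq0 ch0 orbF.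
  by move: m0; rewrite -lead_coef_eq0 lead_coefE sz => /negPf->.
by have := leq_ltn_trans (dvdp_leq m'0 dvd) (lt_size_deriv m0); rewrite ltnn.
Qed.

(** Evaluating a Bezout identity u m + v p = 1 at [x] shows that v(x) inverts p(x). *)
Lemma in_simple_ext_inv y : in_simple_ext x y -> in_simple_ext x y^-1.
Proof.
case=> p Dp; have [y0|y0] := eqVneq y 0; first by exists p; rewrite Dp y0 invr0.
have /minimal_poly_coprime/Bezout_eq1_coprimepP[[u v] /= Duv] :
  ~~ root (p ^ iota) x by rewrite /root Dp.
exists v; have /(congr1 (fun q => (q ^ iota).[x])) := Duv.
rewrite rmorphD !rmorphM rmorph1 /= hornerD !hornerM hornerC Dp.
have /rootP-> : root (m ^ iota) x by case: min_m => _ ->.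
by rewrite mulr0 add0r => /(canRL (mulfK y0)); rewrite mul1r.
Qed.

(** Division by [m] gives spanning; a relation among lower powers is a multiple of [m] of smaller
    degree, hence 0. *)
Lemma simple_ext_basis : (forall y, in_simple_ext x y) ->
  is_quotient_basis (range iota) setT [set 0]
    (fun i : 'I_(size m).-1 => x ^+ i).
Proof.
case: min_m => m0 mP gen; split=> // [y _|c Kc /= c0].
  have [p Dp] := gen y; pose r := p %% m.
  have szr : (size r <= (size m).-1)%N.
    by rewrite -ltnS prednK ?size_poly_gt0 // ltn_modp.
  exists (fun i => iota r`_i) => [i|]; first by exists r`_i.
  apply/eqP; rewrite subr_eq0 -Dp (divp_eq p m) -/r rmorphD rmorphM hornerD hornerM.
  have /rootP-> : root (m ^ iota) x by rewrite mP.
  rewrite mulr0 add0r (@horner_coef_wide _ (size m).-1) ?size_map_poly //.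
  by apply/eqP/eq_bigr => i _; rewrite coef_map.
have /choice[d Dd] i : exists a, iota a = c i by have [a _ <-] := Kc i; exists a.
(* The default 0 is never reached, as j stays below [(size m).-1]. *)
pose p := \poly_(j < (size m).-1) (if insub j is Some i then d i else 0).
have dvd : m %| p.
  rewrite -mP /root (@horner_coef_wide _ (size m).-1) ?size_map_poly ?size_poly //.
  apply/eqP; rewrite -[RHS]c0; apply: eq_bigr => i _.
  by rewrite coef_map coef_poly ltn_ord valK /= Dd.
have p0 : p = 0.
  apply/eqP; apply: contraT => /dvdp_leq/(_ dvd).
  rewrite leqNgt (leq_ltn_trans (size_poly _ _)) //.
  by rewrite prednK ?size_poly_gt0.
move=> i; rewrite -Dd.
have := congr1 (fun q : {poly K} => q`_i) p0.
by rewrite coef_poly ltn_ord valK coef0 /= => ->; rewrite rmorph0.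
Qed.

End Minimal.

Lemma in_simple_ext_trans x y z :
  in_simple_ext x y -> in_simple_ext y z -> in_simple_ext x z.
Proof.
by case=> p <- [q <-]; exists (q \Po p); rewrite map_comp_poly horner_comp.
Qed.

(** The generator of each step is an integer combination of two elements, so it stays in the
    additive group [S]; with [S] the polynomials, the generator is a polynomial. *)
Lemma primitive_element (S : F -> Prop) (s : seq F) :
  [pchar K] =i pred0 -> S 0 -> (forall x y, S x -> S y -> S (x - y)) ->
  (forall x, S x -> algebraic_elt x) -> (forall x, x \in s -> S x) ->
  exists2 x, S x & forall y, y \in s -> in_simple_ext x y.
Proof.
move=> ch0 S0 SB Salg; elim: s => [|y s IHs] Ss; first by exists 0.
have [z zs|x Sx xs] := IHs; first by apply: Ss; rewrite inE zs orbT.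
have Sy : S y by apply: Ss; rewrite inE eqxx.
have [[p p0 px] [q q0 qy]] := (Salg x Sx, Salg y Sy).
have [n /= [zx zy]] := pchar0_PET p0 px q0 qy ch0.
exists (y *+ n - x).
  apply: (SB) => //; elim: n {zx zy} => // n IHn.
  by rewrite mulrS -[y *+ n]opprK -(sub0r (y *+ n)); apply: (SB) => //; apply: (SB).
move=> w; rewrite inE => /orP[/eqP->//|/xs].
exact: in_simple_ext_trans.
Qed.

End SimpleExtension.

(** * Algebraic dependence by counting monomials *)

Lemma exists_left_kernel (F : fieldType) (S T : finType) (C : S -> T -> F) :
  (#|T| < #|S|)%N ->
  exists v : S -> F, (exists s, v s != 0) /\ forall t, \sum_s v s * C s t = 0.
Proof.
move=> lt; pose M := \matrix_(i < #|S|, j < #|T|) C (enum_val i) (enum_val j).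
have : kermx M != 0.
  rewrite -mxrank_eq0 mxrank_ker -lt0n subn_gt0.
  exact: leq_ltn_trans (rank_leq_col M) lt.
case/rowV0Pn => v /sub_kermxP vM v0; exists (fun s => v ord0 (enum_rank s)); split.
  have [j vj] := rV0Pn _ v0.
  by exists (enum_val j); rewrite enum_valK.
move=> t; have := congr1 (fun A : 'rV_#|T| => A ord0 (enum_rank t)) vM.
rewrite !mxE => E; rewrite -[RHS]E (reindex enum_rank) /=; last first.
  by apply: onW_bij; exact: enum_rank_bij.
by apply: eq_bigr => s _; rewrite !mxE !enum_rankK.
Qed.

Section Counting.
Variables (L : fieldType) (N : nat).
Local Notation A := {mpoly L[N]}.

(** [msize] is the total degree plus one, and 0 for the zero polynomial; hence the bounds of the
    form [_.+1]. *)
Lemma msize_mul_le (p q : A) a b :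
  (msize p <= a.+1)%N -> (msize q <= b.+1)%N -> (msize (p * q) <= (a + b).+1)%N.
Proof.
have [->|p0] := eqVneq p 0; first by rewrite mul0r msize0.
have [->|q0] := eqVneq q 0; first by rewrite mulr0 msize0.
move=> ha hb; rewrite msizeM // -ltnS prednK; last first.
  by rewrite addn_gt0 !lt0n !msize_poly_eq0 p0.
by rewrite (leq_trans (leq_add ha hb)) // addnS addSn.
Qed.

Lemma msize_exp_le (p : A) a k :
  (msize p <= a.+1)%N -> (msize (p ^+ k) <= (k * a).+1)%N.
Proof.
move=> ha; elim: k => [|k IHk]; first by rewrite expr0 msize1.
by rewrite exprS mulSn msize_mul_le.
Qed.

Lemma msize_prod_le (I : finType) (p : I -> A) a :
  (forall i, msize (p i) <= a.+1)%N -> (msize (\prod_i p i) <= (#|I| * a).+1)%N.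
Proof.
move=> ha; rewrite cardE -big_enum /=; elim: (enum I) => [|i s IHs].
  by rewrite big_nil msize1.
by rewrite big_cons mulSn msize_mul_le.
Qed.

(* The m^(N+1) products f^alpha g^j with exponents below m have degree O(m),
   hence live in a space of dimension O(m^N). *)
Lemma polynomial_relation (f : N.-tuple A) (g : A) :
  exists m (c : 'I_m -> A),
    (exists j, c j != 0) /\ \sum_j (c j \mPo f) * g ^+ j = 0.
Proof.
have [D [Df Dg]] : exists D,
    (forall i, msize (tnth f i) <= D.+1)%N /\ (msize g <= D.+1)%N.
  exists (\max_i msize (tnth f i) + msize g)%N; split=> [i|].
    by rewrite leqW // (leq_trans _ (leq_addr _ _)) // (leq_bigmax i).
  by rewrite leqW // leq_addl.
(* A product of N+1 powers with exponents below m has degree below M, so its monomials lie in the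
   box [T]. As M <= m E, M^N <= m^N E^N < m^(N+1), which leaves more products than monomials. *)
pose E := (N.+1 * D).+1; pose m := (E ^ N).+1; pose M := (N.+1 * m * D).+1.
pose S := ('I_m * {ffun 'I_N -> 'I_m})%type.
pose T := {ffun 'I_N -> 'I_M}.
pose e (s : S) : A := (\prod_i tnth f i ^+ s.2 i) * g ^+ s.1.
have card_lt : (#|{: T}| < #|{: S}|)%N.
  rewrite card_prod !card_ffun !card_ord -expnS.
  have leM : (M <= m * E)%N.
    by rewrite /M /E mulnS -mulnA mulnCA addnC -addn1 leq_add.
  have -> : (m ^ N.+1 = m ^ N * m)%N by rewrite expnSr.
  apply: leq_ltn_trans (_ : m ^ N * E ^ N < _)%N.
    by rewrite -expnMn; case: (N) => // k; rewrite leq_exp2r.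
  by rewrite ltn_mul2l expn_gt0 /=.
have sze s : (msize (e s) <= M)%N.
  rewrite /M (_ : N.+1 * m * D = N * (m * D) + m * D)%N; last first.
    by rewrite -mulnA mulSn addnC.
  have lem (i : 'I_m) (p : A) :
      (msize p <= D.+1 -> msize (p ^+ i) <= (m * D).+1)%N.
    move=> szp; apply: leq_trans (msize_exp_le i szp) _.
    by rewrite ltnS leq_mul2r ltnW ?orbT.
  apply: msize_mul_le; last exact: lem.
  by rewrite -[X in (X * _)%N](card_ord N); apply: msize_prod_le => i; apply: lem.
pose mon k (t : {ffun 'I_N -> 'I_k}) : 'X_{1..N} := [multinom (t i : nat) | i < N].
have [v [[s0 vs0] vC]] := exists_left_kernel (fun s t => (e s)@_(mon M t)) card_lt.
have ve : \sum_s v s *: e s = 0.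
  apply/mpolyP => k; rewrite mcoeff0 raddf_sum /=.
  under eq_bigr do rewrite mcoeffZ.
  have [/forallP small|/forallPn[i big]] := boolP [forall i, (k i < M)%N].
    have -> : k = mon M [ffun i => Ordinal (small i)].
      by apply/mnmP => i; rewrite mnmE ffunE.
    exact: vC.
  rewrite big1 // => s _; rewrite memN_msupp_eq0 ?mulr0 //.
  apply: msize_mdeg_ge; apply: leq_trans (sze s) _.
  rewrite -leqNgt in big; apply: leq_trans big _.
  by rewrite mdegE (bigD1 i) //= leq_addr.
(* The vanishing combination is grouped by powers of [g]; distinct [a] give distinct monomials, so
   the coefficient [v s0] survives in the entry of index [s0.1]. *)
exists m, (fun j => \sum_(a : {ffun 'I_N -> 'I_m}) v (j, a) *: 'X_[mon m a]); split.
  exists s0.1; apply: contraNneq vs0 => /(congr1 (mcoeff (mon m s0.2))).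
  rewrite mcoeff0 raddf_sum /= (bigD1 s0.2) //= mcoeffZ mcoeffX eqxx mulr1.
  rewrite big1 ?addr0 -?surjective_pairing => [->//|a ane].
  rewrite mcoeffZ mcoeffX; case: eqP => [Ea|]; last by rewrite mulr0.
  case/eqP: ane; apply/ffunP => i; apply: val_inj.
  by move/mnmP/(_ i): Ea; rewrite !mnmE.
rewrite -[RHS]ve.
transitivity (\sum_(j : 'I_m) \sum_(a : {ffun 'I_N -> 'I_m}) v (j, a) *: e (j, a)).
  apply: eq_bigr => j _; rewrite raddf_sum mulr_suml; apply: eq_bigr => a _.
  rewrite /= linearZ /= -scalerAl; congr (_ *: (_ * _)).
  by rewrite comp_mpolyX; apply: eq_bigr => i _; rewrite mnmE.
by rewrite pair_big; apply: eq_bigr => -[].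
Qed.

End Counting.

(** * Specialization of polynomials over a fraction field *)

Section Specialization.
Variables (A : idomainType) (L : fieldType).
Local Notation K := {fraction A}.
Implicit Types (ev : {rmorphism A -> L}) (t c d : L) (F G : {poly K}).

Definition spec_eval ev t (P : {poly A}) : L := (map_poly ev P).[t].

HB.instance Definition _ ev t :=
  GRing.RMorphism.copy (spec_eval ev t) (horner_eval t \o map_poly ev).

(* F in Frac(A)[t] is regular at the point (ev, t) of Spec A[t], with value c. *)
Definition specializes ev t F c :=
  exists P q, [/\ ev q != 0, tofrac q *: F = map_poly (@tofrac A) P
    & spec_eval ev t P = c * ev q].

Lemma spec_evalC ev t a : spec_eval ev t a%:P = ev a.
Proof. by rewrite /spec_eval map_polyC hornerC. Qed.

Lemma spec_evalX ev t : spec_eval ev t 'X = t.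
Proof. by rewrite /spec_eval map_polyX hornerX. Qed.

(** Two presentations of [F] cross-multiply to an identity in A[t], where evaluation makes sense. *)
Lemma specializes_inj ev t F c d :
  specializes ev t F c -> specializes ev t F d -> c = d.
Proof.
move=> [P [q [q0 qF Pc]]] [P' [q' [q'0 qF' Pc']]].
have E : q'%:P * P = q%:P * P'.
  apply: (map_inj_poly (@tofrac_inj A) (tofrac0 A)).
  by rewrite !rmorphM /= -qF -qF' !map_polyC /= !mul_polyC !scalerA mulrC.
have := congr1 (spec_eval ev t) E; rewrite !rmorphM /= !spec_evalC Pc Pc'.
rewrite mulrCA [in RHS]mulrCA [ev q' * _]mulrC => /mulIf; apply.
by rewrite mulf_neq0.
Qed.

Lemma specializesD ev t F G c d :
  specializes ev t F c -> specializes ev t G d ->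
  specializes ev t (F + G) (c + d).
Proof.
move=> [P [q [q0 qF Pc]]] [P' [q' [q'0 qF' Pc']]].
exists (q'%:P * P + q%:P * P'), (q * q'); split.
- by rewrite rmorphM mulf_neq0.
- rewrite rmorphD !rmorphM /= -qF -qF' !map_polyC /= !mul_polyC !scalerA scalerDr.
  by rewrite [tofrac q' * _]mulrC.
- rewrite rmorphD !rmorphM /= !spec_evalC Pc Pc' mulrDl.
  by rewrite mulrCA [in X in _ + X = _]mulrCA [ev q' * _]mulrC.
Qed.

Lemma specializesB ev t F G c d :
  specializes ev t F c -> specializes ev t G d ->
  specializes ev t (F - G) (c - d).
Proof.
move=> Fc [P [q [q0 qG Pd]]]; apply: specializesD => //.
exists (- P), q; split=> //.
  by rewrite scalerN qG rmorphN.
by rewrite rmorphN /= Pd mulNr.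
Qed.

Lemma specializesM ev t F G c d :
  specializes ev t F c -> specializes ev t G d ->
  specializes ev t (F * G) (c * d).
Proof.
move=> [P [q [q0 qF Pc]]] [P' [q' [q'0 qF' Pc']]].
exists (P * P'), (q * q'); split.
- by rewrite rmorphM mulf_neq0.
- by rewrite !rmorphM /= -qF -qF' -scalerAl -scalerAr scalerA.
- by rewrite !rmorphM /= Pc Pc' mulrACA.
Qed.

Lemma specializes_map ev t P :
  specializes ev t (map_poly (@tofrac A) P) (spec_eval ev t P).
Proof. by exists P, 1; rewrite !rmorph1 oner_neq0 scale1r mulr1. Qed.

Lemma specializes_tofrac ev t a : specializes ev t (tofrac a)%:P (ev a).
Proof. by have := specializes_map ev t a%:P; rewrite map_polyC spec_evalC. Qed.

Lemma specializesX ev t : specializes ev t 'X t.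
Proof. by have := specializes_map ev t 'X; rewrite map_polyX spec_evalX. Qed.

Lemma specializes_mmap ev t N (emb : {rmorphism L -> {poly K}}) H h
    (p : {mpoly L[N]}) :
  (forall c, specializes ev t (emb c) c) ->
  (forall i, specializes ev t (H i) (h i)) ->
  specializes ev t (mmap emb H p) p.@[h].
Proof.
move=> Hc Hh; elim/mpoly_ring_ind: p => [c|i|p q Hp Hq|p q Hp Hq].
- by rewrite mmapC mevalC; apply: Hc.
- by rewrite mmapX mmap1U mevalXU; apply: Hh.
- by rewrite raddfD mevalD; apply: specializesD.
- by rewrite rmorphM mevalM; apply: specializesM.
Qed.

Lemma clear_denominators F :
  exists (q : A) P, q != 0 /\ tofrac q *: F = map_poly (@tofrac A) P.
Proof.
elim/poly_ind: F => [|F c [q [P [q0 qF]]]].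
  by exists 1, 0; rewrite oner_neq0 scaler0 rmorph0.
have [a [d [d0 ->]]] := fracP c.
exists (d * q), (d%:P * P * 'X + (q * a)%:P); split; first by rewrite mulf_neq0.
have: tofrac d != 0 by rewrite tofrac_eq0.
rewrite rmorphD rmorphM rmorphM /= !map_polyC map_polyX /= -qF !tofracM.
move: (tofrac d) (tofrac q) (tofrac a) => u v w u0.
have E : (u * v) * (w / u) = v * w by rewrite mulrAC mulrCA divff // mulr1 mulrC.
rewrite scalerDr -(mul_polyC (u * v) (w / u)%:P) -polyCM E; congr (_ + _).
by rewrite mul_polyC scalerA scalerAl.
Qed.

(** The bad locus is cut out by a common denominator of the coefficients; outside it, one polynomial
    over [L] gives the values for all t. *)
Lemma specializes_generic F :
  exists (q : A) (val : {rmorphism A -> L} -> {poly L}), q != 0 /\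
    forall ev, ev q != 0 -> forall t, specializes ev t F (val ev).[t].
Proof.
have [q [P [q0 qF]]] := clear_denominators F.
exists q, (fun ev => (ev q)^-1 *: map_poly ev P); split=> // ev qb t.
by exists P, q; split=> //; rewrite hornerZ mulrAC mulVf // mul1r.
Qed.

End Specialization.

(** * The local ring at a point and multiplicity one *)

Section LocalRing.
Variables (L : closedFieldType) (N : nat).
Local Notation A := {mpoly L[N]}.
Variables (h : N.-tuple A) (x0 : 'rV[L]_N).
Local Notation O := (local_ring x0).
Local Notation I := (local_ideal h x0).

Let den_neq0 (q : A) : q.@[x0 ord0] != 0 -> tofrac q != 0.
Proof.
by apply: contraNneq => /eqP; rewrite tofrac_eq0 => /eqP ->; rewrite meval0.
Qed.

Lemma local_ring_tofrac p : O (tofrac p).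
Proof. by exists p, 1; rewrite meval1 oner_neq0 tofrac1 divr1. Qed.

Lemma local_ring_unit p : p.@[x0 ord0] != 0 -> O (tofrac p)^-1.
Proof. by move=> p0; exists 1, p; rewrite tofrac1 mul1r. Qed.

Lemma local_ringD r s : O r -> O s -> O (r + s).
Proof.
move=> [p [q [q0 ->]]] [p' [q' [q'0 ->]]].
exists (p * q' + p' * q), (q * q'); rewrite mevalM mulf_neq0 //; split=> //.
by rewrite addf_div ?den_neq0 // !(tofracD, tofracM).
Qed.

Lemma local_ringM r s : O r -> O s -> O (r * s).
Proof.
move=> [p [q [q0 ->]]] [p' [q' [q'0 ->]]].
exists (p * p'), (q * q'); rewrite mevalM mulf_neq0 //; split=> //.
by rewrite mulf_div !tofracM.
Qed.

Lemma local_ideal0 : I 0.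
Proof.
exists (fun=> 0) => [i|]; last by rewrite big1 // => i _; rewrite mul0r.
by rewrite -tofrac0; apply: local_ring_tofrac.
Qed.

Lemma local_idealD r s : I r -> I s -> I (r + s).
Proof.
move=> [c Oc ->] [d Od ->]; exists (fun i => c i + d i) => [i|].
  exact: local_ringD.
by rewrite -big_split; apply: eq_bigr => i _; rewrite mulrDl.
Qed.

Lemma local_idealM r s : O r -> I s -> I (r * s).
Proof.
move=> Or [c Oc ->]; exists (fun i => r * c i) => [i|]; first exact: local_ringM.
by rewrite mulr_sumr; apply: eq_bigr => i _; rewrite mulrA.
Qed.

Lemma local_idealB r s : I r -> I s -> I (r - s).
Proof.
move=> Ir Is; apply: local_idealD => //; rewrite -mulN1r -tofrac1 -tofracN.
by apply: local_idealM => //; apply: local_ring_tofrac.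
Qed.

Lemma local_ideal_gen i : I (tofrac (tnth h i)).
Proof.
exists (fun j => tofrac (i == j)%:R%:MP) => [j|]; first exact: local_ring_tofrac.
rewrite (bigD1 i) //= eqxx mpolyC1 tofrac1 mul1r big1 ?addr0 // => j.
by rewrite eq_sym => /negPf ->; rewrite mpolyC0 tofrac0 mul0r.
Qed.

Lemma local_ideal_cancel r p :
  p.@[x0 ord0] != 0 -> I (tofrac p * r) -> I r.
Proof.
move=> p0 Ipr; rewrite -[r](mulKf (den_neq0 p0)).
by apply: local_idealM => //; apply: local_ring_unit.
Qed.

(** The generators vanish at a solution; this makes the ideal proper. *)
Lemma local_ideal_vanish r : solution h x0 -> I r ->
  exists p q, [/\ q.@[x0 ord0] != 0, p.@[x0 ord0] = 0 & r = tofrac p / tofrac q].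
Proof.
move=> sol [c Oc ->]; elim/big_ind: _ => [|r1 r2|i _].
- by exists 0, 1; rewrite meval0 meval1 oner_neq0 tofrac0 mul0r.
- move=> [p [q [q0 p0 ->]]] [p' [q' [q'0 p'0 ->]]].
  exists (p * q' + p' * q), (q * q'); rewrite mevalM mulf_neq0 //; split=> //.
    by rewrite mevalD !mevalM p0 p'0 !mul0r addr0.
  by rewrite addf_div ?den_neq0 // !(tofracD, tofracM).
- have [p [q [q0 ->]]] := Oc i; exists (p * tnth h i), q; split=> //.
    by rewrite mevalM sol mulr0.
  by rewrite tofracM mulrAC.
Qed.

Lemma local_ideal_eval p :
  (forall i, I (tofrac ('X_i - (x0 ord0 i)%:MP))) ->
  I (tofrac (p - (p.@[x0 ord0])%:MP)).
Proof.
move=> IX; elim/mpoly_ring_ind: p => [c|i|p1 p2 Hp Hq|p1 p2 Hp Hq].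
- by rewrite mevalC subrr tofrac0; apply: local_ideal0.
- by rewrite mevalXU.
- rewrite mevalD mpolyCD opprD addrACA tofracD; exact: local_idealD.
rewrite mevalM mpolyCM; set a := _%:MP in Hp *; set b := _%:MP in Hq *.
have -> : p1 * p2 - a * b = p2 * (p1 - a) + a * (p2 - b).
  by rewrite !mulrBr addrA mulrC [p2 * a]mulrC subrK.
by rewrite tofracD !tofracM; apply: local_idealD; apply: local_idealM => //;
  apply: local_ring_tofrac.
Qed.

(** The ideal contains the maximal ideal and is proper, so the quotient is [L], with basis 1. *)
Lemma multiplicity1 : solution h x0 ->
  (forall i, I (tofrac ('X_i - (x0 ord0 i)%:MP))) -> multiplicity h x0 = 1%N.
Proof.
move=> sol IX; apply: (@quotient_dimE _ _ _ _ _ (fun _ : 'I_1 => 1)).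
- by exists 1 => //; rewrite mpolyC1 tofrac1.
- by move=> _ _ [c _ <-] [d _ <-]; exists (c - d) => //; rewrite mpolyCB tofracB.
- by move=> _ _ [c _ <-] [d _ <-]; exists (c * d) => //; rewrite mpolyCM tofracM.
- exact: local_ideal0.
- exact: local_idealB.
- by move=> _ r [c _ <-]; apply: local_idealM; apply: local_ring_tofrac.
split=> [_|r [p [q [q0 ->]]]|c cK].
- by rewrite -tofrac1; apply: local_ring_tofrac.
(* The residue class of p / q is its value at [x0]. *)
- pose c := p.@[x0 ord0] / q.@[x0 ord0].
  exists (fun=> tofrac c%:MP) => [i|]; first by exists c.
  rewrite big_ord1 mulr1; apply: (local_ideal_cancel q0).
  have -> : tofrac q * (tofrac p / tofrac q - tofrac c%:MP)
    = tofrac ((p - (p.@[x0 ord0])%:MP) - c%:MP * (q - (q.@[x0 ord0])%:MP)).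
    rewrite mulrBr mulrCA divff ?den_neq0 // mulr1 -tofracM -tofracB.
    congr tofrac; rewrite mulrBr -mpolyCM divfK // opprB addrA subrK.
    by rewrite [q * _]mulrC.
  rewrite tofracB tofracM; apply: local_idealB.
    exact: local_ideal_eval.
  apply: local_idealM; [exact: local_ring_tofrac | exact: local_ideal_eval].
(* A constant in the ideal vanishes at [x0], hence is 0. *)
rewrite big_ord1 mulr1 => /(local_ideal_vanish sol)[p [q [q0 p0 Ec]]] i.
rewrite ord1; have [a _ Ea] := cK ord0; move: Ec; rewrite -Ea.
move/(congr1 (fun z => z * tofrac q)); rewrite divfK ?den_neq0 // -tofracM.
move/eqP; rewrite tofrac_eq => /eqP/(congr1 (meval (x0 ord0))).
rewrite mevalM mevalC p0 => /eqP; rewrite mulf_eq0 (negPf q0) orbF => /eqP ->.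
by rewrite mpolyC0 tofrac0.
Qed.

End LocalRing.

(** * Pullback of function fields and evaluation of its identities *)

Section Pullback.
Variables (A B : idomainType) (phi : {rmorphism A -> B}).
Hypothesis phi_inj : injective phi.

Lemma tofrac_comp_inj : injective (@tofrac B \o phi).
Proof. by move=> x y /tofrac_inj/phi_inj. Qed.

Definition pullback : {rmorphism {fraction A} -> {fraction B}} :=
  frac_lift tofrac_comp_inj.

Lemma pullback_tofrac a : pullback (tofrac a) = tofrac (phi a).
Proof. exact: frac_lift_tofrac. Qed.

(** Moves an identity of the fraction field into [B], where it can be evaluated at points or read
    modulo an ideal. *)
Lemma cleared_relation (F : {poly {fraction A}}) q P theta p :
  (map_poly pullback F).[tofrac theta] = tofrac p ->
  tofrac q *: F = map_poly (@tofrac A) P ->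
  phi q * p = (map_poly phi P).[theta].
Proof.
move=> Fp qF; apply/eqP; rewrite -tofrac_eq; apply/eqP.
rewrite tofracM -Fp -pullback_tofrac -hornerZ -map_polyZ qF -map_poly_comp.
rewrite -horner_map -map_poly_comp; congr (_.[_]).
by apply: eq_map_poly => a /=; rewrite frac_lift_tofrac.
Qed.

(** [evx] is a point over [ev]; in the cleared identity evaluated there, the non-zero factor [ev q]
    cancels. *)
Lemma specializes_fiber (L : fieldType) (ev : {rmorphism A -> L})
    (evx : {rmorphism B -> L}) F theta p c :
  (forall a, evx (phi a) = ev a) ->
  (map_poly pullback F).[tofrac theta] = tofrac p ->
  specializes ev (evx theta) F c -> c = evx p.
Proof.
move=> evE Fp [P [q [q0 qF Pc]]].
have := congr1 evx (cleared_relation Fp qF).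
rewrite rmorphM evE -horner_map -map_poly_comp.
rewrite (eq_map_poly (g := ev)) // -/(spec_eval ev _ P) Pc mulrC.
by move/(mulIf q0).
Qed.

End Pullback.

Lemma horner_mmap (L : comNzRingType) (K F : fieldType) (iota : {rmorphism K -> F})
    N (emb : {rmorphism L -> {poly K}}) (H : 'I_N -> {poly K})
    (tau : {rmorphism {mpoly L[N]} -> F}) x :
  (forall c, (map_poly iota (emb c)).[x] = tau c%:MP) ->
  (forall i, (map_poly iota (H i)).[x] = tau 'X_i) ->
  forall p, (map_poly iota (mmap emb H p)).[x] = tau p.
Proof.
move=> Hc HX; elim/mpoly_ring_ind => [c|i|p q Hp Hq|p q Hp Hq].
- by rewrite mmapC; apply: Hc.
- by rewrite mmapX mmap1U; apply: HX.
- by rewrite raddfD !rmorphD hornerD Hp Hq.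
- by rewrite !rmorphM hornerM Hp Hq.
Qed.

(** * Congruences modulo an ideal *)

Section Congruence.
Variables (B : comNzRingType) (J : B -> Prop).
Hypotheses (J0 : J 0) (JD : forall x y, J x -> J y -> J (x + y)).
Hypothesis JM : forall x y, J y -> J (x * y).

Lemma ideal_congM x x' y y' : J (x - x') -> J (y - y') -> J (x * y - x' * y').
Proof.
move=> Jx Jy; have -> : x * y - x' * y' = y * (x - x') + x' * (y - y').
  by rewrite !mulrBr addrA mulrC [y * x']mulrC subrK.
by apply: JD; apply: JM.
Qed.

Lemma ideal_congD x x' y y' : J (x - x') -> J (y - y') -> J (x + y - (x' + y')).
Proof. by move=> Jx Jy; rewrite opprD addrACA; apply: JD. Qed.

Lemma ideal_cong_mpoly (L : comNzRingType) N (F G : {rmorphism {mpoly L[N]} -> B}) :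
  (forall c, F c%:MP = G c%:MP) -> (forall i, J (F 'X_i - G 'X_i)) ->
  forall p, J (F p - G p).
Proof.
move=> FGC FGX; elim/mpoly_ring_ind => [c|i|p q Hp Hq|p q Hp Hq].
- by rewrite FGC subrr.
- exact: FGX.
- by rewrite !rmorphD; apply: ideal_congD.
- by rewrite !rmorphM; apply: ideal_congM.
Qed.

Lemma ideal_cong_horner (A : comNzRingType) (F G : {rmorphism A -> B}) x y :
  (forall a, J (F a - G a)) -> J (x - y) ->
  forall P, J ((map_poly F P).[x] - (map_poly G P).[y]).
Proof.
move=> FG Jxy; elim/poly_ind => [|P c IHP]; first by rewrite !rmorph0 !horner0 subrr.
rewrite !rmorphD !rmorphM /= !map_polyC !map_polyX !hornerMXaddC.
by apply: ideal_congD; [exact: ideal_congM | exact: FG].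
Qed.

End Congruence.

(** * A polynomial primitive element for a dominant map *)

Section FractionSimple.
Variables (B : idomainType) (K : fieldType) (iota : {rmorphism K -> {fraction B}}).

Lemma in_simple_ext_frac x :
  algebraic_elt iota x -> (forall b, in_simple_ext iota x (tofrac b)) ->
  forall y, in_simple_ext iota x y.
Proof.
move=> /minimal_polyP[m min_m] gen y; have [a [b [_ ->]]] := fracP y.
have [p <-] := gen a; have [q <-] := in_simple_ext_inv min_m (gen b).
by exists (p * q); rewrite rmorphM hornerM.
Qed.

End FractionSimple.

Section Dominant.
Variables (L : closedFieldType) (N : nat).
Hypothesis ch0 : [pchar L] =i pred0.
Local Notation A := {mpoly L[N]}.
Local Notation K := {fraction A}.
Variable f : N.-tuple A.
Hypothesis f_inj : injective (comp_mpoly f).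

Local Notation iota := (@pullback _ _ (comp_mpoly f) f_inj).

Lemma pullback_field_range : pullback_field f = range iota.
Proof.
apply/predeqP => r; split=> [[p [q [q0 ->]]]|[x _ <-]].
  by exists (tofrac p / tofrac q) => //; rewrite fmorph_div !pullback_tofrac.
have [p [q [q0 ->]]] := fracP x; exists p, q; split=> //.
by rewrite fmorph_div !pullback_tofrac.
Qed.

(** The counting relation is a polynomial equation for [g] over [K], because [iota] sends c_j to c_j
    composed with [f]. *)
Lemma tofrac_algebraic (g : A) : algebraic_elt iota (tofrac g).
Proof.
have [m [c [[j cj] rel]]] := polynomial_relation f g.
pose p := \poly_(i < m) (if insub i is Some i then tofrac (c i) else 0).
have pE (i : 'I_m) : p`_i = tofrac (c i) by rewrite coef_poly ltn_ord valK.
exists p.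
  apply: contraNneq cj => p0; rewrite -tofrac_eq0 -pE p0 coef0 //.
rewrite /root (@horner_coef_wide _ m) ?size_map_poly ?size_poly //.
rewrite -[X in _ == X](tofrac0 A) -rel raddf_sum; apply/eqP/eq_bigr => i _.
by rewrite coef_map pE /= pullback_tofrac tofracM tofracXn.
Qed.

Lemma pchar_frac_mpoly : [pchar K] =i pred0.
Proof.
apply/pcharf0P => k; rewrite -(rmorph_nat (@tofrac A)) tofrac_eq0 -mpolyC_nat.
by rewrite mpolyC_eq0; move/pcharf0P: ch0.
Qed.

(** A generator that is a polynomial can be evaluated at every point of a fibre. *)
Lemma primitive_polynomial :
  exists theta : A, forall y, in_simple_ext iota (tofrac theta) y.
Proof.
have [||_ [x _ <-]|_ /codomP[i ->]|_ [theta _ <-] gen] :=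
  @primitive_element K K iota (range (@tofrac A))
    (codom (fun i : 'I_N => tofrac 'X_i)) pchar_frac_mpoly.
- by exists 0; rewrite ?tofrac0.
- by move=> _ _ [x _ <-] [y _ <-]; exists (x - y); rewrite ?tofracB.
- exact: tofrac_algebraic.
- by exists 'X_i.
exists theta; apply: in_simple_ext_frac (tofrac_algebraic _) _.
elim/mpoly_ring_ind => [c|i|p q [P Dp] [Q Dq]|p q [P Dp] [Q Dq]].
- exists (tofrac c%:MP)%:P.
  by rewrite map_polyC hornerC /= pullback_tofrac /= comp_mpolyC.
- by apply: gen; apply/codomP; exists i.
- by exists (P + Q); rewrite tofracD rmorphD hornerD Dp Dq.
- by exists (P * Q); rewrite tofracM rmorphM hornerM Dp Dq.
Qed.

End Dominant.

(** * Generic specialization of a separable polynomial *)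

Section GenericSpecialization.
Variables (A : idomainType) (L : closedFieldType).
Local Notation K := {fraction A}.
Implicit Types (ev : {rmorphism A -> L}) (m G : {poly K}).

Lemma specializes_multiple m G : m %| G ->
  exists D : A, D != 0 /\ forall ev, ev D != 0 -> forall t,
    specializes ev t m 0 -> specializes ev t G 0.
Proof.
case/dvdpP => Q ->; have [D [val [D0 valP]]] := specializes_generic L Q.
exists D; split=> // ev evD t mt; rewrite -(mulr0 (val ev).[t]).
by apply: specializesM => //; apply: valP.
Qed.

(** The cleared form [m0] keeps the denominator [q] explicit; [c] absorbs the leading
    coefficient. *)
Definition splits_at ev m (rs : seq L) :=
  exists (q : A) (m0 : {poly A}) (c : L), [/\ ev q != 0, c != 0,
    tofrac q *: m = map_poly (@tofrac A) m0
    & map_poly ev m0 = c *: \prod_(r <- rs) ('X - r%:P)].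

Lemma splits_at_root ev m rs t : splits_at ev m rs ->
  specializes ev t m 0 <-> t \in rs.
Proof.
move=> [q [m0 [c [q0 c0 qm Em0]]]].
have spec_m : specializes ev t m ((map_poly ev m0).[t] / ev q).
  by exists m0, q; rewrite divfK.
rewrite -root_prod_XsubC -(rootZ _ _ c0) -Em0 /root.
split=> [/specializes_inj/(_ spec_m)/esym/eqP|/eqP m0t].
  by rewrite mulf_eq0 invr_eq0 (negPf q0) orbF.
by move: spec_m; rewrite m0t mul0r.
Qed.

Lemma generic_splitting m : coprimep m m^`() ->
  exists D : A, D != 0 /\ forall ev, ev D != 0 ->
    exists rs, [/\ uniq rs, size rs = (size m).-1 & splits_at ev m rs].
Proof.
move=> cop; have m_neq0 : m != 0.
  by apply: contraTneq cop => ->; rewrite deriv0 coprime0p eqp01.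
case/Bezout_eq1_coprimepP: cop => [[u v] /= Duv].
have [q [m0 [q0 qm]]] := clear_denominators m.
have [qu [vu [qu0 vuP]]] := specializes_generic L u.
have [qv [vv [qv0 vvP]]] := specializes_generic L v.
have szm0 : size m0 = size m.
  rewrite -(size_scale m (a := tofrac q)) ?tofrac_eq0 // qm.
  by rewrite (size_map_inj_poly (@tofrac_inj A) (tofrac0 A)).
have m0_neq0 : m0 != 0 by rewrite -size_poly_eq0 szm0 size_poly_eq0.
(* [q] makes [m] regular, the leading coefficient prevents a drop of degree, and [qu], [qv] let the
   Bezout coefficients specialize. *)
exists (q * lead_coef m0 * (qu * qv)); split.
  by rewrite !mulf_neq0 ?lead_coef_eq0.
move=> ev; rewrite !rmorphM !mulf_eq0 !negb_or.
move=> /andP[/andP[evq evl] /andP[evu evv]].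
have [rs Ers] := closed_field_poly_normal (map_poly ev m0).
have szmb : size (map_poly ev m0) = size m by rewrite size_map_poly_id0.
set c := lead_coef _ in Ers.
have c0 : c != 0 by rewrite lead_coef_eq0 -size_poly_eq0 szmb size_poly_eq0.
have splits : splits_at ev m rs by exists q, m0, c.
exists rs; split=> //; last first.
  by rewrite -szmb Ers size_scale // size_prod_XsubC.
(* At a common root of the specialized polynomial and its derivative, u m + v m' = 1 would
   specialize to 0 = 1. *)
rewrite -separable_prod_XsubC unlock.
apply/Pdiv.ClosedField.coprimepP => t; rewrite root_prod_XsubC.
move=> /(splits_at_root t splits) mt.
have spec_m' : specializes ev t m^`() ((map_poly ev m0)^`().[t] / ev q).
  exists m0^`(), q; split=> //; first by rewrite -derivZ qm deriv_map.
  by rewrite divfK // deriv_map.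
have := specializesD (specializesM (vuP ev evu t) mt)
  (specializesM (vvP ev evv t) spec_m').
rewrite Duv mulr0 add0r Ers derivZ hornerZ => spec1.
apply/eqP => P0; move: spec1; rewrite P0 !(mulr0, mul0r).
have := specializes_map ev t 1; rewrite !rmorph1 => s1 s0.
by have /eqP := specializes_inj s1 s0; rewrite oner_eq0.
Qed.

End GenericSpecialization.

(** * Parametrization of a fibre by the values of theta, and simplicity of its points *)

Section Fiber.
Variables (L : closedFieldType) (N : nat).
Local Notation A := {mpoly L[N]}.
Local Notation K := {fraction A}.
Variable f : N.-tuple A.
Hypothesis f_inj : injective (comp_mpoly f).
Local Notation iota := (@pullback _ _ (comp_mpoly f) f_inj).
Variables (theta : A) (m : {poly K}) (H : 'I_N -> {poly K}).
Hypothesis min_m : is_minimal_poly iota m (tofrac theta).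
Hypothesis m_sep : coprimep m m^`().
Hypothesis HX : forall i, (map_poly iota (H i)).[tofrac theta] = tofrac 'X_i.

(** [rs] holds the values of theta on the fibre over [b], and [pt] maps a parameter t to the point
    with coordinates H_i(b, t). *)
Definition fiber_at (b : 'rV[L]_N) (rs : seq L) (pt : L -> 'rV[L]_N) :=
  [/\ uniq rs, splits_at (meval (b ord0)) m rs,
      forall t i, specializes (meval (b ord0)) t (H i) (pt t ord0 i)
    & forall t, t \in rs -> polymap f (pt t) = b /\ theta.@[pt t ord0] = t].

Lemma fiber_generic : exists D : A, D != 0 /\ forall b : 'rV[L]_N,
  D.@[b ord0] != 0 ->
  exists rs pt, size rs = (size m).-1 /\ fiber_at b rs pt.
Proof.
pose emb : {rmorphism L -> {poly K}} := polyC \o (@tofrac A \o @mpolyC N L).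
have emb_spec b t c : specializes (meval b) t (emb c) c.
  by have := specializes_tofrac (meval b) t c%:MP; rewrite /= mevalC.
have GE : forall p, (map_poly iota (mmap emb H p)).[tofrac theta] = tofrac p.
  apply: (horner_mmap (tau := @tofrac A)) => // c.
  by rewrite /= map_polyC hornerC /= pullback_tofrac /= comp_mpolyC.
case: (min_m) => _ mP.
have dvd_theta : m %| mmap emb H theta - 'X.
  by rewrite -mP /root rmorphB hornerD hornerN GE /= map_polyX hornerX subrr.
have dvd_f j : m %| mmap emb H (tnth f j) - (tofrac 'X_j)%:P.
  rewrite -mP /root rmorphB hornerD hornerN GE /= map_polyC hornerC /=.
  by rewrite pullback_tofrac /= comp_mpolyXU -tnth_nth subrr.
have [D1 [D1n D1P]] := generic_splitting L m_sep.
have [D2 [D2n D2P]] := specializes_multiple L dvd_theta.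
have /choice[D3 D3P] := fun j => specializes_multiple L (dvd_f j).
have /choice[D4 /choice[val D4P]] := fun i => specializes_generic L (H i).
(* [D1] gives simple roots, [D2] and [D3] carry the congruences modulo [m] over to these roots, and
   [D4] makes the H_i regular. *)
exists (D1 * D2 * (\prod_j D3 j * \prod_i D4 i)); split.
  rewrite !mulf_neq0 //; apply/prodf_neq0 => j _.
    by have [] := D3P j.
  by have [] := D4P j.
move=> b; rewrite !rmorphM !rmorph_prod !mulf_eq0 !negb_or.
move=> /andP[/andP[bD1 bD2] /andP[/prodf_neq0 bD3 /prodf_neq0 bD4]].
have [rs [rsU szrs splits]] := D1P _ bD1.
pose pt t : 'rV[L]_N := \row_i (val i (meval (b ord0))).[t].
have ptP t i : specializes (meval (b ord0)) t (H i) (pt t ord0 i).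
  by rewrite mxE; have [_ P] := D4P i; apply/P/bD4.
have GP t p : specializes (meval (b ord0)) t (mmap emb H p) p.@[pt t ord0].
  exact: specializes_mmap.
exists rs, pt; split=> //; split=> // t.
move=> /(splits_at_root t splits) mt; split.
  apply/rowP => j; rewrite mxE; apply/eqP; rewrite -subr_eq0.
  have [_ /(_ _ (bD3 j isT) t mt) s0] := D3P j.
  apply/eqP; apply: specializes_inj s0; rewrite -[b ord0 j](mevalXU (b ord0)).
  by apply: specializesB; [exact: GP | exact: specializes_tofrac].
apply/eqP; rewrite -subr_eq0; apply/eqP; apply: specializes_inj (D2P _ bD2 t mt).
by apply: specializesB; [exact: GP | exact: specializesX].
Qed.

Variables (b : 'rV[L]_N) (rs : seq L) (pt : L -> 'rV[L]_N).
Hypothesis fib : fiber_at b rs pt.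

Let meval_f x p : polymap f x = b -> (p \mPo f).@[x ord0] = p.@[b ord0].
Proof.
by move=> <-; rewrite comp_mpoly_meval; apply: meval_eq => i; rewrite mxE.
Qed.

(** At [x], the identity m(theta) = 0 puts theta(x) among the roots, and x_i = H_i(theta) recovers
    [x] from theta(x). *)
Lemma fiber_point x : polymap f x = b ->
  theta.@[x ord0] \in rs /\ x = pt theta.@[x ord0].
Proof.
case: fib => _ splits ptP _ fx; case: (min_m) => _ mP; split.
  apply/(splits_at_root _ splits).
  case: (splits) => q [m0 [c [q0 c0 qm Em0]]].
  exists m0, q; split=> //; rewrite mul0r.
  (* Zero is written [tofrac 0] to fit [cleared_relation] with p = 0. *)
  have m_root : (map_poly iota m).[tofrac theta] = tofrac 0.
    by rewrite tofrac0; apply/eqP; rewrite -/(root _ _) mP.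
  have := congr1 (meval (x ord0)) (cleared_relation m_root qm).
  rewrite mulr0 meval0 -horner_map -map_poly_comp => E; rewrite [RHS]E.
  rewrite /spec_eval; congr (_.[_]); apply: eq_map_poly => a /=.
  by rewrite meval_f.
apply/rowP => i; have := specializes_fiber (evx := meval (x ord0)) _ (HX i) (ptP _ i).
by rewrite /= mevalXU => <- // a; apply: meval_f.
Qed.

Definition fiber_system : N.-tuple A := [tuple tnth f l - (b ord0 l)%:MP | l < N].

Lemma solution_fiber_system x : solution fiber_system x <-> polymap f x = b.
Proof.
split=> [sol|fx l].
  apply/rowP => l; apply/eqP; rewrite -subr_eq0 mxE.
  by have := sol l; rewrite tnth_mktuple mevalB mevalC => ->.
by rewrite tnth_mktuple mevalB mevalC -fx mxE subrr.
Qed.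

Lemma fiber_simple t : t \in rs -> simple_solution fiber_system (pt t).
Proof.
move=> trs; case: (fib) => rsU splits ptP /(_ t trs)[fpt thpt].
case: (min_m) => _ mP.
have sol : solution fiber_system (pt t) by apply/solution_fiber_system.
(* Non-zero at [pt t], zero at the other points of the fibre: it isolates [pt t] and is a unit of
   the local ring there. *)
pose others := \prod_(r <- rs | r != t) (theta - r%:MP).
have othersE (x : 'rV[L]_N) :
    others.@[x ord0] = \prod_(r <- rs | r != t) (theta.@[x ord0] - r).
  by rewrite rmorph_prod; apply: eq_bigr => r _; rewrite /= mevalB mevalC.
have others0 : others.@[pt t ord0] != 0.
  rewrite othersE prodf_seq_neq0; apply/allP => r _; apply/implyP.
  by rewrite thpt subr_eq0 eq_sym.
split.
  split=> //.
  exists [set x : 'rV[L]_N |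
    exists2 p, [set others]%classic p & p.@[x ord0] != 0]%classic.
  split; [by exists [set others]%classic | by exists others|].
  move=> x [_ -> /=]; rewrite othersE => ox.
  move=> /solution_fiber_system/fiber_point[xrs ->].
  congr pt; apply/eqP; apply: contraNT ox => xt.
  by rewrite (big_rem _ xrs) /= xt subrr mul0r.
(* The trace of the local ideal on polynomials, so that congruences avoid fractions. *)
pose J p := local_ideal fiber_system (pt t) (tofrac p).
have J0 : J 0 by rewrite /J tofrac0; apply: local_ideal0.
have JD p q : J p -> J q -> J (p + q) by rewrite /J tofracD; apply: local_idealD.
have JM p q : J q -> J (p * q).
  by rewrite /J tofracM; apply: local_idealM; apply: local_ring_tofrac.
have Jcancel p q : p.@[pt t ord0] != 0 -> J (p * q) -> J q.
  by rewrite /J tofracM; apply: local_ideal_cancel.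
(* [C] evaluates at [b]; it agrees with composition by [f] modulo [J], because the generators are
   the f_i - b_i. *)
pose C : {rmorphism A -> A} := @mpolyC N L \o meval (b ord0).
have Jf p : J (p \mPo f - C p).
  apply: (ideal_cong_mpoly J0 JD JM (F := comp_mpoly f) (G := C)) => [c|i] /=.
    by rewrite comp_mpolyC mevalC.
  rewrite comp_mpolyXU mevalXU -tnth_nth /J.
  by have := local_ideal_gen fiber_system (pt t) i; rewrite tnth_mktuple.
have Jtheta : J (theta - t%:MP).
  case: (splits) => q [m0 [c [q0 c0 qm Em0]]].
  have m_root : (map_poly iota m).[tofrac theta] = tofrac 0.
    by rewrite tofrac0; apply/eqP; rewrite -/(root _ _) mP.
  have E : (map_poly C m0).[theta] = (c%:MP * others) * (theta - t%:MP).
    rewrite map_poly_comp Em0 map_polyZ rmorph_prod hornerZ horner_prod.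
    (* As [rs] has no repetition, theta - t splits off once and leaves [others]. *)
    rewrite (bigD1_seq t) //= -mulrA [others * _]mulrC; congr (_ * (_ * _)).
      by rewrite map_polyXsubC hornerXsubC.
    by apply: eq_bigr => r _; rewrite map_polyXsubC hornerXsubC.
  (* Under composition with [f] the value of [m0] at theta is 0, so c others (theta - t) lies in
     [J], and c others is a unit at [pt t]. *)
  have := ideal_cong_horner J0 JD JM (F := comp_mpoly f) (G := C) Jf
    (x := theta) (y := theta).
  rewrite subrr => /(_ J0 m0); rewrite -(cleared_relation m_root qm) mulr0 E.
  rewrite sub0r -mulrN => /Jcancel J'; rewrite -[theta - _]opprK -mulN1r.
  by apply/JM/J'; rewrite mevalM mevalC mulf_neq0.
(* With q H_i = P, modulo [J] one has q(b) x_i = q(f) x_i = P(f, theta) = P(b, t) = q(b) H_i(b, t),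
   and the non-zero constant q(b) cancels. *)
apply: multiplicity1 => // i; have [P [q [q0 qH Pt]]] := ptP t i.
have := ideal_cong_horner J0 JD JM (F := comp_mpoly f) (G := C) Jf Jtheta P.
rewrite -(cleared_relation (HX i) qH) map_poly_comp horner_map /=.
rewrite -/(spec_eval _ _ P) Pt => JH.
apply: (Jcancel q.@[b ord0]%:MP); first by rewrite mevalC.
suff -> : q.@[b ord0]%:MP * ('X_i - (pt t ord0 i)%:MP)
    = ((q \mPo f) * 'X_i - (pt t ord0 i * q.@[b ord0])%:MP)
      + - 'X_i * (q \mPo f - C q) by apply: JD => //; apply: JM.
rewrite mpolyCM /= mulNr !mulrBr opprB ['X_i * (_ \mPo _)]mulrC.
by rewrite [RHS]addrC addrA subrK ['X_i * _]mulrC [_%:MP * q.@[_]%:MP]mulrC.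
Qed.

End Fiber.

(** * The generic fibre of a polynomial map *)

Section GenericFiber.
Variables (L : closedFieldType) (N : nat).
Hypothesis ch0 : [pchar L] =i pred0.
Variable f : N.-tuple {mpoly L[N]}.

(** A non-zero [p] killed by composition with [f] would define a non-empty open set that the image
    misses. *)
Lemma dense_comp_inj :
  zariski_dense (range (polymap f)) -> injective (comp_mpoly f).
Proof.
move=> dense; apply: raddf_inj => p pf; apply/eqP; apply: contraT => p0.
have [v pv] := mpoly_nonvanishing ch0 p0.
have [||y [[_ -> px] [x _ Ex]]] :=
    dense [set x : 'rV[L]_N | exists2 q, [set p]%classic q & q.@[x ord0] != 0]%classic.
- by exists [set p]%classic.
- by exists v, p.
case/eqP: px; rewrite -Ex.
have := comp_mpoly_meval (x ord0) p f; rewrite pf meval0 => ->.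
by apply: meval_eq => i; rewrite mxE.
Qed.

Theorem generic_fiber : exists D : {mpoly L[N]}, D != 0 /\
  forall b : 'rV[L]_N, D.@[b ord0] != 0 -> exists s : seq 'rV[L]_N,
    [/\ uniq s, size s = degree f, forall x, x \in s <-> polymap f x = b
      & forall x, x \in s -> simple_solution (fiber_system f b) x].
Proof.
rewrite /degree; case: asboolP => [dense|]; last first.
  (* The image misses a non-empty open set; a polynomial defining part of it serves as [D], with
     empty fibres matching the conventional degree 0. *)
  move=> /existsNP[U /not_implyP[[S ->] /not_implyP[[v [D SD Dv]] disj]]].
  exists D; split=> [|b Db]; first by apply: contraNneq Dv => ->; rewrite meval0.
  exists [::]; split=> // x; split=> // fx; case: disj; exists b.
  by split; [exists D | exists x].
have f_inj := dense_comp_inj dense.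
have [theta gen] := primitive_polynomial ch0 f_inj.
have [m min_m] := minimal_polyP (tofrac_algebraic f_inj theta).
have sep := minimal_poly_separable min_m (pchar_frac_mpoly N ch0).
have /choice[H HX] := fun i => gen (tofrac 'X_i).
have deg : ext_degree (pullback_field f) = (size m).-1.
  rewrite (pullback_field_range f_inj).
  apply: quotient_dimE (simple_ext_basis min_m gen).
  - by exists 1; rewrite ?rmorph1.
  - by move=> _ _ [x _ <-] [y _ <-]; exists (x - y); rewrite ?rmorphB.
  - by move=> _ _ [x _ <-] [y _ <-]; exists (x * y); rewrite ?rmorphM.
  - by [].
  - by move=> x y /= -> ->; rewrite subrr.
  - by move=> x y _ /= ->; rewrite mulr0.
have [D [D0 DP]] := fiber_generic min_m sep HX.
exists D; split=> // b /DP[rs [pt [szrs fib]]].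
have [rsU _ _ rsP] := fib.
exists [seq pt t | t <- rs]; split.
(* theta is a left inverse of [pt] on [rs]. *)
- rewrite map_inj_in_uniq // => t u /rsP[_ {2}<-] /rsP[_ {2}<-] E.
  by rewrite E.
- by rewrite size_map szrs deg.
- move=> x; split=> [/mapP[t /rsP[ft _] ->] //|].
  by move=> /(fiber_point min_m HX fib)[trs Ex]; apply/mapP; eexists; eauto.
- by move=> x /mapP[t trs ->]; apply: (fiber_simple min_m HX fib).
Qed.

End GenericFiber.

(** * Transfer to matrices *)

Theorem theorem2 (L : closedFieldType) (charL0 : [pchar L] =i pred0)
    (n k : nat) (n_ge2 : (2 <= n)%N) (A : 'I_k -> 'M[L]_n)
    (g : ncpoly L k.+1) (g_neq0 : g <> 0)
    (g_last : forall m : fmonom 'I_k.+1,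
       m \in monalg.msupp g -> ord_max \in (m : seq 'I_k.+1)) :
  let delta := degree (phi_mpoly A g) in
  generically (fun B : 'M[L]_n =>
    exists s : seq 'M[L]_n,
      [/\ uniq s,
          size s = delta,
          forall X : 'M[L]_n, X \in s <-> phi A g X = B
        & forall X : 'M[L]_n, X \in s ->
            simple_solution (phi_system A g B) (mxvec X)]).
Proof.
have [D [D0 DP]] := generic_fiber charL0 (phi_mpoly A g).
exists [set B | D.@[mxvec B ord0] != 0]%classic; split.
- exists [set D]%classic; apply/predeqP => v /=; rewrite vec_mxK.
  by split=> [Dv|[_ ->]] //; exists D.
- have [v Dv] := mpoly_nonvanishing charL0 D0.
  by exists (vec_mx v); rewrite /= vec_mxK.
move=> B /DP[s [sU szs sP simple]].
have mem_s X : (X \in map vec_mx s) = (mxvec X \in s).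
  by rewrite -[X in LHS]mxvecK mem_map //; apply: can_inj vec_mxK.
exists (map vec_mx s); split.
- by rewrite map_inj_uniq //; apply: can_inj vec_mxK.
- by rewrite size_map.
- move=> X; rewrite mem_s; split=> [/sP|EX]; last by apply/sP; rewrite polymap_phi EX.
  by rewrite polymap_phi => /(can_inj mxvecK).
(* [phi_system A g B] unfolds to the [fiber_system] of [phi_mpoly A g] at [mxvec B]. *)
- by move=> X; rewrite mem_s; apply: simple.
Qed.
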